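(* Let $k\geq 2$ be an integer and let $G_l(q)$, $l\geq 1$, be the sequence of formal series defined in the context. Then for every $j\geq 0$ and every $i\in\{1,\dots,k\}$ there is a formal power series $\gamma(q)\in\mathbb{C}[[q]]$ such that $$G_{(k-1)j+i}(q)=1+q^{2j+1}\gamma(q).$$
   Context: $q$ is a formal variable and all series are formal (Laurent) series in $q$. Fix an integer $k\geq 2$. For $1\leq i\leq k$ define $$G_i(q)=\prod_{\substack{m\geq 1,\ m\not\equiv 2\ (\mathrm{mod}\ 4),\\ m\not\equiv 0,\ 2k+(2i-1),\ 2k-(2i-1)\ (\mathrm{mod}\ 4k)}}(1-q^m)^{-1}.$$ Every integer $l\geq k+1$ can be written uniquely as $l=(k-1)j+i$ with $j\geq 1$ and $2\leq i\leq k$ (note $(k-1)j+1=(k-1)(j-1)+k$). For such $l$ define recursively $$G_{(k-1)j+i}(q)=\frac{G_{(k-1)(j-1)+k-i+1}(q)-G_{(k-1)(j-1)+k-i+2}(q)}{q^{2j(i-1)}}-q^{-1}G_{(k-1)j+i-1}(q),$$ the right-hand side involving only indices smaller than $(k-1)j+i$. *)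

(* Defs.v *)
From HB Require Import structures.
From mathcomp Require Import all_boot all_order all_algebra.
From mathcomp Require Import zify.
From mathcomp Require Import boolp reals complex.

Set Implicit Arguments.
Unset Strict Implicit.
Unset Printing Implicit Defensive.

Import GRing.Theory.
Local Open Scope ring_scope.
Local Open Scope quotient_scope.

(* The ring K[[q]], for K a field; f n is the coefficient of q^n in f. *)
Record powser (K : fieldType) := PowSer { coefs :> nat -> K }.

Section PowerSeries.
Variable K : fieldType.
Implicit Types f g h : powser K.

Lemma powserP f g : (forall n, f n = g n) -> f = g.
Proof. by case: f g => f [g] /= fg; congr PowSer; apply/funext. Qed.

HB.instance Definition _ := gen_eqMixin (powser K).
HB.instance Definition _ := gen_choiceMixin (powser K).

Definition ps0 : powser K := PowSer (fun=> 0).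
Definition ps_opp f : powser K := PowSer (fun n => - f n).
Definition ps_add f g : powser K := PowSer (fun n => f n + g n).

Fact ps_addA : associative ps_add.
Proof. by move=> f g h; apply: powserP => n /=; rewrite addrA. Qed.
Fact ps_addC : commutative ps_add.
Proof. by move=> f g; apply: powserP => n /=; rewrite addrC. Qed.
Fact ps_add0 : left_id ps0 ps_add.
Proof. by move=> f; apply: powserP => n /=; rewrite add0r. Qed.
Fact ps_addN : left_inverse ps0 ps_opp ps_add.
Proof. by move=> f; apply: powserP => n /=; rewrite addNr. Qed.

HB.instance Definition _ :=
  GRing.isZmodule.Build (powser K) ps_addA ps_addC ps_add0 ps_addN.

Definition ps1 : powser K := PowSer (fun n => (n == 0%N)%:R).
Definition ps_mul f g : powser K :=
  PowSer (fun n => \sum_(i < n.+1) f i * g (n - i)%N).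

Let trunc N f : {poly K} := \poly_(i < N.+1) f i.

Let trunc_coef N f n : (n <= N)%N -> (trunc N f)`_n = f n.
Proof. by move=> nN; rewrite coef_poly ltnS nN. Qed.

Let ps_mulE N f g n : (n <= N)%N -> ps_mul f g n = (trunc N f * trunc N g)`_n.
Proof.
move=> nN; rewrite coefM /=; apply: eq_bigr => i _.
by rewrite !trunc_coef //; have := ltn_ord i; lia.
Qed.

Fact ps_mulC : commutative ps_mul.
Proof. by move=> f g; apply: powserP => n; rewrite !(ps_mulE _ _ (leqnn n)) mulrC. Qed.

Fact ps_mulA : associative ps_mul.
Proof.
move=> f g h; apply: powserP => n.
have -> : ps_mul f (ps_mul g h) n = (trunc n f * (trunc n g * trunc n h))`_n.
  rewrite coefM [LHS]/=; apply: eq_bigr => i _.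
  by rewrite trunc_coef -?ps_mulE //; have := ltn_ord i; lia.
have -> : ps_mul (ps_mul f g) h n = (trunc n f * trunc n g * trunc n h)`_n.
  rewrite coefM [LHS]/=; apply: eq_bigr => i _.
  by rewrite trunc_coef -?ps_mulE //; have := ltn_ord i; lia.
by rewrite mulrA.
Qed.

Fact ps_mul1 : left_id ps1 ps_mul.
Proof.
move=> f; apply: powserP => n /=.
rewrite big_ord_recl /= mul1r subn0 big1 ?addr0 // => i _.
by rewrite mul0r.
Qed.

Fact ps_mulDl : left_distributive ps_mul ps_add.
Proof.
move=> f g h; apply: powserP => n /=; rewrite -big_split /=.
by apply: eq_bigr => i _; rewrite mulrDl.
Qed.

Fact ps1_neq0 : ps1 != 0.
Proof.
apply/eqP => /(congr1 (fun f : powser K => f 0%N)) /= /eqP.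
by rewrite oner_eq0.
Qed.

HB.instance Definition _ := GRing.Zmodule_isComNzRing.Build (powser K)
  ps_mulA ps_mulC ps_mul1 ps_mulDl ps1_neq0.

Lemma coefs0 n : (0 : powser K) n = 0. Proof. by []. Qed.
Lemma coefs1 n : (1 : powser K) n = (n == 0%N)%:R. Proof. by []. Qed.
Lemma coefsN f n : (- f) n = - f n. Proof. by []. Qed.
Lemma coefsD f g n : (f + g) n = f n + g n. Proof. by []. Qed.
Lemma coefsB f g n : (f - g) n = f n - g n. Proof. by []. Qed.
Lemma coefsM f g n : (f * g) n = \sum_(i < n.+1) f i * g (n - i)%N.
Proof. by []. Qed.
Lemma coefs0M f g : (f * g) 0%N = f 0%N * g 0%N.
Proof. by rewrite coefsM big_ord1. Qed.

(* Congruence modulo q^n. *)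
Definition eqmodq n f g := forall t, (t < n)%N -> f t = g t.

Lemma eqmodqM n f f' g g' :
  eqmodq n f f' -> eqmodq n g g' -> eqmodq n (f * g) (f' * g').
Proof.
move=> ff gg t tn; rewrite !coefsM; apply: eq_bigr => i _.
by rewrite ff ?gg //; have := ltn_ord i; lia.
Qed.

Lemma coefsX_small f n t : f 0%N = 0 -> (t < n)%N -> (f ^+ n) t = 0.
Proof.
move=> f0; elim: n t => // n IHn t tn; rewrite exprS coefsM.
rewrite big_ord_recl f0 mul0r add0r big1 // => i _ /=.
by rewrite IHn ?mulr0 // /bump /=; have := ltn_ord i; lia.
Qed.

Definition psC (c : K) : powser K := PowSer (fun n => c *+ (n == 0%N)).

Lemma coefsCM c f n : (psC c * f) n = c * f n.
Proof.
rewrite coefsM big_ord_recl /= mulr1n subn0 big1 ?addr0 // => i _ /=.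
by rewrite mul0r.
Qed.

(* For f = c (1 - h) with c = f 0 <> 0 and h 0 = 0, the inverse is
   c^-1 (1 + h + h^2 + ...); only h^0, ..., h^n contribute to q^n. *)
Definition ps_unit f := f 0%N != 0.
Definition ps_geom h : powser K := PowSer (fun n => (\sum_(t < n.+1) h ^+ t) n).
Definition ps_inv f : powser K :=
  if ps_unit f then psC (f 0%N)^-1 * ps_geom (1 - psC (f 0%N)^-1 * f) else f.

Lemma coefs_sum (I : Type) (r : seq I) (P : pred I) (F : I -> powser K) n :
  (\sum_(i <- r | P i) F i) n = \sum_(i <- r | P i) F i n.
Proof. by elim/big_rec2: _ => // i x y _ <-. Qed.

Lemma ps_geomP h : h 0%N = 0 -> (1 - h) * ps_geom h = 1.
Proof.
move=> h0; apply: powserP => n.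
have E : eqmodq n.+1 (ps_geom h) (\sum_(t < n.+1) h ^+ t).
  move=> t tn; rewrite [LHS]/= !coefs_sum.
  rewrite -!(big_mkord predT (fun i => (h ^+ i) t)).
  rewrite [RHS](@big_cat_nat _ _ _ t.+1) //= [X in _ + X]big_nat_cond.
  rewrite [X in _ + X]big1 ?addr0 // => i; rewrite andbT => /andP[ti _].
  exact: coefsX_small.
rewrite (eqmodqM (g' := \sum_(t < n.+1) h ^+ t) (f' := 1 - h) _ E) //.
have -> : (1 - h) * (\sum_(t < n.+1) h ^+ t) = 1 - h ^+ n.+1.
  by rewrite -opprB mulNr -subrX1 opprB.
by rewrite coefsB coefsX_small ?subr0.
Qed.

Fact ps_mulVf : {in ps_unit, left_inverse 1 ps_inv *%R}.
Proof.
move=> f f0; rewrite /ps_inv (f0 : ps_unit f).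
rewrite mulrAC -[X in X * _](subKr 1) ps_geomP //.
by rewrite coefsB coefs1 coefsCM mulVf // subrr.
Qed.

Fact ps_unitPl f g : g * f = 1 -> ps_unit f.
Proof.
move=> /(congr1 (fun h : powser K => h 0%N)); rewrite coefs0M coefs1 /ps_unit.
by apply: contra_eq_neq => ->; rewrite mulr0 eq_sym oner_eq0.
Qed.

Fact ps_inv_out : {in [predC ps_unit], ps_inv =1 id}.
Proof. by move=> f /negbTE f0; rewrite /ps_inv (f0 : ps_unit f = false). Qed.

HB.instance Definition _ := GRing.ComNzRing_hasMulInverse.Build (powser K)
  ps_mulVf ps_unitPl ps_inv_out.

Lemma ps_unitE f : (f \is a GRing.unit) = (f 0%N != 0). Proof. by []. Qed.

(* The formal variable q. *)
Definition ps_q : powser K := PowSer (fun n => (n == 1%N)%:R).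

Lemma coefs_qXM n f t : (ps_q ^+ n * f) t = if (t < n)%N then 0 else f (t - n)%N.
Proof.
elim: n f t => [|n IHn] f t; first by rewrite mul1r subn0.
rewrite exprSr -mulrA IHn; case: ltnP => tn; first by rewrite ifT // ltnW.
rewrite coefsM; case: ltnP => tn'.
  have -> : (t - n = 0)%N by lia.
  by rewrite big_ord1 mul0r.
have n1 : (1 < (t - n).+1)%N by lia.
rewrite (bigD1 (Ordinal n1)) //= mul1r big1 ?addr0 => [|i Hi].
  by congr (f _); lia.
rewrite (_ : ((i : nat) == 1%N) = false) ?mul0r //.
by apply: contraNF Hi => Hi; apply/eqP/val_inj/eqP.
Qed.

Lemma coefs_qX n t : (ps_q ^+ n) t = (t == n)%:R.
Proof.
rewrite -[_ ^+ n]mulr1 coefs_qXM coefs1; case: ltnP => tn.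
  by rewrite (ltn_eqF tn).
by rewrite subn_eq0 eqn_leq tn andbT.
Qed.

Lemma ps_factor f : f != 0 ->
  exists n g, g \is a GRing.unit /\ f = ps_q ^+ n * g.
Proof.
move=> f0.
have : exists n, f n != 0.
  apply: contrapT => H; case/eqP: f0; apply: powserP => n.
  by apply/eqP/negPn/negP => fn; apply: H; exists n.
case/ex_minnP => n fn Hn; exists n, (PowSer (fun t => f (t + n)%N)); split.
  by rewrite ps_unitE /= add0n.
apply: powserP => t; rewrite coefs_qXM; case: ltnP => tn /=; last by rewrite subnK.
by apply/eqP; apply: contraTT tn => /Hn; rewrite -leqNgt.
Qed.

Lemma ps_q_neq0 : ps_q != 0.
Proof.
apply/eqP => /(congr1 (fun f : powser K => f 1%N)) /= /eqP.
by rewrite oner_eq0.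
Qed.

Fact ps_integral f g : f * g = 0 -> (f == 0) || (g == 0).
Proof.
move=> fg; apply/orP.
case: (eqVneq f 0) => [|/ps_factor [m [u [uU Ef]]]]; [by left|right].
have E : ps_q ^+ m * g = 0.
  by apply: (mulrI uU); rewrite mulr0 mulrA [u * _]mulrC -Ef.
apply/eqP/powserP => t.
have : (ps_q ^+ m * g) (t + m)%N = 0 by rewrite E.
by rewrite coefs_qXM ltnNge leq_addl /= addnK.
Qed.

HB.instance Definition _ := GRing.ComUnitRing_isIntegral.Build (powser K)
  ps_integral.

(* The infinite product of the F m, over the m >= 1 satisfying P: the factors
   with m > n do not affect the coefficient of q^n when F m = 1 + O(q^m). *)
Definition ps_iprod (P : pred nat) (F : nat -> powser K) : powser K :=
  PowSer (fun n => (\prod_(1 <= m < n.+1 | P m) F m) n).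

Lemma ps_iprodE (P : pred nat) (F : nat -> powser K) N n :
  (forall m, P m -> eqmodq m (F m) 1) -> (n <= N)%N ->
  ps_iprod P F n = (\prod_(1 <= m < N.+1 | P m) F m) n.
Proof.
move=> HF; elim: N => [|N IHN]; first by rewrite leqn0 => /eqP ->.
rewrite leq_eqVlt => /orP[/eqP -> //|nN]; rewrite IHN // [in RHS]big_mkcond big_nat_recr //=.
rewrite -big_mkcond /= -[in LHS](mulr1 (\prod_(_ <= _ < _ | _) _)).
apply: (eqmodqM (n := N.+1)) => // t tN.
by case: ifP => // PN; rewrite HF.
Qed.

End PowerSeries.

(* The field K((q)) of formal Laurent series, as the fraction field of K[[q]];
   see laurentP. The injection of f : powser K is f%:F. *)
Notation laurent K := {fraction (powser K)}.
Notation "f %:F" := (FracField.tofrac f) : ring_scope.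

Definition lq (K : fieldType) : laurent K := (ps_q K)%:F.

Lemma laurentP (K : fieldType) (F : laurent K) :
  exists n (f : powser K), F = f%:F / lq K ^+ n.
Proof.
have [n [d [d0 ->]]] : exists n d, d != 0 /\ F = n%:F / d%:F.
  exists \n_(repr F), \d_(repr F); split; first exact: denom_ratioP.
  rewrite -[LHS]reprK; move: (repr F) => x; rewrite -[x in LHS]Ratio_numden.
  unlock FracField.tofrac.
  rewrite -[_^-1]FracField.pi_inv -[RHS]FracField.pi_mul /FracField.invf.
  by rewrite /FracField.mulf !numden_Ratio ?oner_neq0 ?denom_ratioP // mulr1 mul1r.
have [m [u [uU ->]]] := ps_factor d0; exists m, (n / u).
by rewrite !rmorphM rmorphXn rmorphV // invfM mulrCA mulrC.
Qed.

(* The integers m >= 1 occurring in the product G_i; for 1 <= i <= k the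
   subtractions in nat are genuine. *)
Definition G_index (k i : nat) : pred nat := fun m =>
  [&& m != 2 %[mod 4],
      m != 0 %[mod 4 * k],
      m != 2 * k + (2 * i - 1) %[mod 4 * k] &
      m != 2 * k - (2 * i - 1) %[mod 4 * k]]%N.

Definition G_prod (K : fieldType) (k i : nat) : powser K :=
  ps_iprod (G_index k i) (fun m => (1 - ps_q K ^+ m)^-1).

Lemma G_prodE (K : fieldType) (k i N n : nat) : (n <= N)%N ->
  G_prod K k i n =
  (\prod_(1 <= m < N.+1 | G_index k i m) (1 - ps_q K ^+ m)^-1) n.
Proof.
apply: ps_iprodE => m Pm t tm.
have m0 : (0 < m)%N by case: m tm {Pm}.
have U : 1 - ps_q K ^+ m \is a GRing.unit.
  by rewrite ps_unitE coefsB coefs1 coefs_qX (ltn_eqF m0) subr0 oner_eq0.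
transitivity (((1 - ps_q K ^+ m)^-1 * 1) t); first by rewrite mulr1.
transitivity (((1 - ps_q K ^+ m)^-1 * (1 - ps_q K ^+ m)) t); last by rewrite mulVr.
apply: (eqmodqM (n := m)) => // s sm.
by rewrite coefsB coefs_qX (ltn_eqF sm) subr0.
Qed.

(* G is the sequence (G_l), l >= 1; G 0 is irrelevant. *)
Definition is_G_sequence (K : fieldType) (k : nat) (G : nat -> laurent K) :=
  (forall i, (1 <= i <= k)%N -> G i = (G_prod K k i)%:F) /\
  (forall j i, (1 <= j)%N -> (2 <= i <= k)%N ->
     G ((k - 1) * j + i)%N =
       (G ((k - 1) * (j - 1) + k - i + 1)%N
        - G ((k - 1) * (j - 1) + k - i + 2)%N) / lq K ^+ (2 * j * (i - 1))
       - (lq K)^-1 * G ((k - 1) * j + i - 1)%N).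

Fixpoint G_fuel (K : fieldType) (k n l : nat) : laurent K :=
  if n is n'.+1 then
    if (l <= k)%N then (G_prod K k l)%:F else
    let j := ((l - 2) %/ (k - 1))%N in
    let i := ((l - 2) %% (k - 1) + 2)%N in
    (G_fuel K k n' ((k - 1) * (j - 1) + k - i + 1)%N
     - G_fuel K k n' ((k - 1) * (j - 1) + k - i + 2)%N) / lq K ^+ (2 * j * (i - 1))
    - (lq K)^-1 * G_fuel K k n' (l - 1)%N
  else 0.

Lemma G_indexing (k l : nat) : (2 <= k)%N -> (k < l)%N -> exists j i,
  [/\ l = ((k - 1) * j + i)%N, (1 <= j)%N, (2 <= i <= k)%N,
      ((l - 2) %/ (k - 1) = j)%N & ((l - 2) %% (k - 1) + 2 = i)%N].
Proof.
move=> k2 kl; exists ((l - 2) %/ (k - 1))%N, ((l - 2) %% (k - 1) + 2)%N.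
have k1 : (0 < k - 1)%N by lia.
have := divn_eq (l - 2) (k - 1); have := ltn_pmod (l - 2) k1.
have : (0 < (l - 2) %/ (k - 1))%N by rewrite divn_gt0 //; lia.
move: (_ %/ _)%N (_ %% _)%N => j r j0 rk E; split => //; nia.
Qed.

Lemma G_fuelS (K : fieldType) (k n n' l : nat) : (2 <= k)%N ->
  (l < n)%N -> (l < n')%N -> G_fuel K k n l = G_fuel K k n' l.
Proof.
move=> k2; elim: n n' l => // n IHn [//|n'] l ln ln' /=.
case: leqP => // kl; have [j [i [El j1 ik -> ->]]] := G_indexing k2 kl.
have Ej : ((k - 1) * j = (k - 1) * (j - 1) + (k - 1))%N by nia.
by congr ((_ - _) / _ - _ * _); apply: IHn; lia.
Qed.

Lemma G_sequence_exists (K : fieldType) (k : nat) : (2 <= k)%N ->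
  exists G : nat -> laurent K, is_G_sequence k G.
Proof.
move=> k2; exists (fun l => G_fuel K k l.+1 l); split => [i /andP[_ ik]|j i j1 ik].
  by rewrite [LHS]/= ik.
have Ej : ((k - 1) * j = (k - 1) * (j - 1) + (k - 1))%N by nia.
set l := ((k - 1) * j + i)%N; have kl : (k < l)%N by rewrite /l; lia.
rewrite [LHS]/= ifF; last by rewrite leqNgt kl.
have k1 : (0 < k - 1)%N by lia.
have El2 : (l - 2 = j * (k - 1) + (i - 2))%N by rewrite /l; lia.
have ik' : (i - 2 < k - 1)%N by lia.
rewrite El2 divnMDl // modnMDl divn_small // modn_small // addn0 subnK; last by lia.
by congr ((_ - _) / _ - _ * _); apply: G_fuelS => //; rewrite /l; lia.
Qed.

Lemma G_sequence_unique (K : fieldType) (k : nat) (G G' : nat -> laurent K) :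
  (2 <= k)%N -> is_G_sequence k G -> is_G_sequence k G' ->
  forall l, (1 <= l)%N -> G l = G' l.
Proof.
move=> k2 [Gi Gr] [Gi' Gr'] l; have [n] := ubnP l; elim: n l => // n IHn l ln l1.
case: (leqP l k) => kl; first by rewrite Gi ?Gi' ?l1.
have [j [i [El j1 ik _ _]]] := G_indexing k2 kl.
have Ej : ((k - 1) * j = (k - 1) * (j - 1) + (k - 1))%N by nia.
rewrite El Gr // Gr' //.
by congr ((_ - _) / _ - _ * _); apply: IHn; lia.
Qed.

(* Main.v *)
Require Import Defs.
From mathcomp Require Import all_boot all_order all_algebra.
From mathcomp Require Import zify ring.
From mathcomp Require Import boolp reals complex.

(* Each G_l is given by a closed form. Up to the product P of the (1 - q^m)^-1
   over m <> 2 mod 4, G_{(k-1)j+i} is Andrews' function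
   J_{k,k-i+1}(a; x; Q) at a = -1/q, x = q^(2j), Q = q^2, where
     J_{k,s}(x) = H_{k,s}(xQ) - axQ H_{k,s-1}(xQ)
   and H_{k,s} is an explicit alternating series. Shifting the summation index
   in half of the terms gives H_{k,s}(x) - H_{k,s-1}(x) = x^(s-1) J_{k,k-s+1}(x),
   which is the recursion defining G_l. At j = 0 the series collapses to a theta
   series, which the Jacobi triple product (obtained as a limit of the
   q-binomial theorem) identifies with G_1, ..., G_k. Finally, only the term of
   index 0 of the series contributes modulo q^(2j+1), and P times that term is
   1 modulo q^(2j+1). *)

Set Implicit Arguments.
Unset Strict Implicit.
Unset Printing Implicit Defensive.

Import GRing.Theory.
Local Open Scope ring_scope.

(** * Congruences modulo powers of q and infinite sums of power series *)

Section CongruencePowers.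
Variable K : fieldType.
Implicit Types f g h : powser K.
Local Notation q := (ps_q K).

Lemma eqmodqxx n f : eqmodq n f f.
Proof. by []. Qed.

Lemma eqmodq_sym n f g : eqmodq n f g -> eqmodq n g f.
Proof. by move=> fg t tn; rewrite fg. Qed.

Lemma eqmodq_trans n f g h : eqmodq n f g -> eqmodq n g h -> eqmodq n f h.
Proof. by move=> fg gh t tn; rewrite fg ?gh. Qed.

Lemma eqmodq_leq m n f g : (m <= n)%N -> eqmodq n f g -> eqmodq m f g.
Proof. by move=> mn fg t tm; apply: fg; apply: leq_trans mn. Qed.

Lemma eqmodqD n f f' g g' :
  eqmodq n f f' -> eqmodq n g g' -> eqmodq n (f + g) (f' + g').
Proof. by move=> ff gg t tn; rewrite !coefsD ff ?gg. Qed.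

Lemma eqmodqN n f g : eqmodq n f g -> eqmodq n (- f) (- g).
Proof. by move=> fg t tn; rewrite !coefsN fg. Qed.

Lemma eqmodq_sum n (I : Type) (r : seq I) (P : pred I) (F G : I -> powser K) :
  (forall i, P i -> eqmodq n (F i) (G i)) ->
  eqmodq n (\sum_(i <- r | P i) F i) (\sum_(i <- r | P i) G i).
Proof. by move=> FG; elim/big_ind2: _ => // *; apply: eqmodqD. Qed.

Lemma eqmodq_sum0 n (I : Type) (r : seq I) (P : pred I) (F : I -> powser K) :
  (forall i, P i -> eqmodq n (F i) 0) -> eqmodq n (\sum_(i <- r | P i) F i) 0.
Proof.
move=> F0; elim/big_ind: _ => // f g f0 g0.
by rewrite -(addr0 0); apply: eqmodqD.
Qed.

Lemma eqmodq_prod1 n (I : Type) (r : seq I) (P : pred I) (F : I -> powser K) :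
  (forall i, P i -> eqmodq n (F i) 1) -> eqmodq n (\prod_(i <- r | P i) F i) 1.
Proof.
move=> F1; elim/big_ind: _ => // f g f1 g1.
by rewrite -(mulr1 1); apply: eqmodqM.
Qed.

Lemma eqmodq_eq f g : (forall n, eqmodq n f g) -> f = g.
Proof. by move=> fg; apply: powserP => n; apply: (fg n.+1). Qed.

Lemma eqmodq_qXM m n d f g :
  (n <= d + m)%N -> eqmodq m f g -> eqmodq n (q ^+ d * f) (q ^+ d * g).
Proof.
move=> ndm fg t tn; rewrite !coefs_qXM; case: ltnP => // dt.
by apply: fg; lia.
Qed.

Lemma eqmodq_qX0 n d f : (n <= d)%N -> eqmodq n (q ^+ d * f) 0.
Proof. by move=> nd t tn; rewrite coefs_qXM (leq_trans tn nd). Qed.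

Lemma eqmodq_1BqX n d : (n <= d)%N -> eqmodq n (1 - q ^+ d) 1.
Proof.
move=> nd t tn; rewrite coefsB -[q ^+ d]mulr1.
by rewrite (eqmodq_qX0 _ nd) // subr0.
Qed.

Lemma eqmodqMI n u f g :
  u \is a GRing.unit -> eqmodq n (u * f) (u * g) -> eqmodq n f g.
Proof.
move=> uU /(eqmodqM (eqmodqxx (n := n) u^-1)).
by rewrite !mulrA mulVr // !mul1r.
Qed.

(** This turns a congruence modulo q^(2j+1) into the series gamma of the theorem. *)
Lemma eqmodqP n f g : eqmodq n f g -> exists h, f = g + q ^+ n * h.
Proof.
move=> fg; exists (PowSer (fun t => f (t + n)%N - g (t + n)%N)).
apply: powserP => t; rewrite coefsD coefs_qXM; case: ltnP => tn.
  by rewrite fg ?addr0.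
by rewrite /= subnK // addrC subrK.
Qed.

Lemma unit_1DqX d : (0 < d)%N -> 1 + q ^+ d \is a GRing.unit.
Proof.
by move=> d0; rewrite ps_unitE coefsD coefs_qX (ltn_eqF d0) addr0 oner_neq0.
Qed.

Lemma unit_1BqX d : (0 < d)%N -> 1 - q ^+ d \is a GRing.unit.
Proof.
by move=> d0; rewrite ps_unitE coefsB coefs_qX (ltn_eqF d0) subr0 oner_neq0.
Qed.

(* Meaningful when the order of vanishing of [F t] is at least [t]. *)
Definition ps_sum (F : nat -> powser K) : powser K :=
  PowSer (fun n => (\sum_(t < n.+1) F t) n).

Definition ps_summable (F : nat -> powser K) := forall t, eqmodq t (F t) 0.

Lemma eqmodq_ps_sum F N :
  ps_summable F -> eqmodq N (ps_sum F) (\sum_(t < N) F t).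
Proof.
move=> F0 n nN /=; rewrite !coefs_sum.
rewrite -!(big_mkord predT (fun i => F i n)).
rewrite [RHS](@big_cat_nat _ _ _ n.+1) //= [X in _ + X]big_nat_cond.
rewrite [X in _ + X]big1 ?addr0 // => i; rewrite andbT => /andP[ni _].
exact: F0.
Qed.

Lemma eq_ps_sum F G : F =1 G -> ps_sum F = ps_sum G.
Proof. by move=> /funext ->. Qed.

Lemma ps_sumD F G : ps_sum (fun n => F n + G n) = ps_sum F + ps_sum G.
Proof. by apply: powserP => n; rewrite /= big_split. Qed.

Lemma ps_sumB F G : ps_sum (fun n => F n - G n) = ps_sum F - ps_sum G.
Proof. by apply: powserP => n; rewrite /= sumrB. Qed.

Lemma ps_sumMl c F : ps_summable F -> ps_sum (fun n => c * F n) = c * ps_sum F.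
Proof.
move=> F0; apply: eqmodq_eq => n.
apply: (eqmodq_trans (eqmodq_ps_sum _)) => [t|].
  by rewrite -(mulr0 c); apply: eqmodqM.
rewrite -mulr_sumr; apply: eqmodqM => //.
exact/eqmodq_sym/eqmodq_ps_sum.
Qed.

Lemma ps_sum_recl F : ps_summable F -> ps_sum F = F 0%N + ps_sum (fun n => F n.+1).
Proof.
move=> F0; apply: eqmodq_eq => n.
apply: (eqmodq_trans (eqmodq_leq (leqnSn n) (eqmodq_ps_sum F0))).
rewrite big_ord_recl; apply: eqmodqD => //.
apply/eqmodq_sym/eqmodq_ps_sum => t.
exact: (eqmodq_leq (leqnSn t)).
Qed.

End CongruencePowers.

(** * The series H and J and their functional equation *)

Section AndrewsFunctions.
Variable K : fieldType.
Local Notation q := (ps_q K).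

(** The q-Pochhammer symbols (-q; q^2)_n and, next, (q^2; q^2)_n. *)
Definition odd_poch n : powser K := \prod_(m < n) (1 + q ^+ (2 * m + 1)).
Definition even_poch n : powser K := \prod_(m < n) (1 - q ^+ (2 * m + 2)).

Lemma odd_pochS n : odd_poch n.+1 = odd_poch n * (1 + q ^+ (2 * n + 1)).
Proof. exact: big_ord_recr. Qed.

Lemma even_pochS n : even_poch n.+1 = even_poch n * (1 - q ^+ (2 * n + 2)).
Proof. exact: big_ord_recr. Qed.

Lemma unit_odd_poch n : odd_poch n \is a GRing.unit.
Proof.
elim: n => [|n IHn]; first by rewrite /odd_poch big_ord0 unitr1.
by rewrite odd_pochS unitrM IHn unit_1DqX ?addn1.
Qed.

Lemma unit_even_poch n : even_poch n \is a GRing.unit.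
Proof.
elim: n => [|n IHn]; first by rewrite /even_poch big_ord0 unitr1.
by rewrite even_pochS unitrM IHn unit_1BqX ?addn2.
Qed.

(** Pochhammer part of the n-th term of H_{k,s} at x = q^(2j+2). The infinite products become finite
    quotients once the common factor (-q; q^2)_oo / (q^2; q^2)_oo is removed. *)
Definition andrews_coef j n :=
  odd_poch n * even_poch (n + j) / (even_poch n * odd_poch (n + j).+1).

Lemma andrews_coefP j n :
  even_poch n * odd_poch (n + j).+1 * andrews_coef j n =
  odd_poch n * even_poch (n + j).
Proof. by rewrite mulrC divrK // unitrM unit_even_poch unit_odd_poch. Qed.

(** Together with [andrews_coef_recr], it lets every term in [H_sum_diff] be expressed through the
    coefficients for j + 1. *)
Lemma andrews_coef_recl j n :
  andrews_coef j n * (1 - q ^+ (2 * (n + j).+1)) =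
  andrews_coef j.+1 n * (1 + q ^+ (2 * (n + j).+1 + 1)).
Proof.
have U : even_poch n * odd_poch (n + j).+2 \is a GRing.unit.
  by rewrite unitrM unit_even_poch unit_odd_poch.
apply: (mulrI U); rewrite [RHS]mulrA -[in RHS](addnS n) andrews_coefP addnS.
rewrite even_pochS odd_pochS mulrACA.
have -> : (2 * (n + j) + 2 = 2 * (n + j).+1)%N by lia.
set y := 1 - _; set x := 1 + q ^+ _.
transitivity (even_poch n * odd_poch (n + j).+1 * andrews_coef j n * x * y).
  by ring.
by rewrite andrews_coefP; ring.
Qed.

Lemma andrews_coef_recr j n :
  andrews_coef j n.+1 * (1 - q ^+ (2 * n.+1)) =
  andrews_coef j.+1 n * (1 + q ^+ (2 * n + 1)).
Proof.
have U : even_poch n * odd_poch (n + j).+2 \is a GRing.unit.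
  by rewrite unitrM unit_even_poch unit_odd_poch.
apply: (mulrI U); rewrite [RHS]mulrA -[in RHS](addnS n) andrews_coefP addnS.
have := andrews_coefP j n.+1; rewrite addSn even_pochS [odd_poch n.+1]odd_pochS.
have -> : (2 * n + 2 = 2 * n.+1)%N by lia.
set y := 1 - _; set x := 1 + q ^+ _ => E.
transitivity (even_poch n * y * odd_poch (n + j).+2 * andrews_coef j n.+1).
  by ring.
by rewrite E; ring.
Qed.

(** For j = 0 the even symbols cancel and the odd ones leave a single factor; this is what makes the
    series at j = 0 a theta series. *)
Lemma andrews_coef0 n : (1 + q ^+ (2 * n + 1)) * andrews_coef 0 n = 1.
Proof.
have U : even_poch n * odd_poch n \is a GRing.unit.
  by rewrite unitrM unit_even_poch unit_odd_poch.
apply: (mulrI U); have := andrews_coefP 0 n; rewrite addn0 odd_pochS mulr1.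
by move=> E; rewrite [RHS]mulrC -[RHS]E; ring.
Qed.

Variable k : nat.

(* The series H_{k,s}(a; x; q) of Andrews at a = -1/q, x = q^(2j+2) and base
   q^2, divided by the product of the (1 - q^m)^-1 over m <> 2 mod 4. *)
Definition H_exp j s n := (2 * n * (k * (n + j) + (k - s)) + n)%N.
Definition H_term j s n :=
  (-1) ^+ n * andrews_coef j n * q ^+ H_exp j s n
  * (1 - q ^+ (2 * s * (2 * n + j).+1)).
Definition H_sum j s := ps_sum (H_term j s).
(** The second index is shifted: this is J_{k,s+1} at x = q^(2j), up to the same product, and
    q^(2j+1) is -axQ. *)
Definition J_sum j s := H_sum j s.+1 + q ^+ (2 * j + 1) * H_sum j s.

Lemma H_term_summable j s : ps_summable (H_term j s).
Proof.
move=> n; rewrite /H_term -mulrA mulrCA; apply: eqmodq_qX0; rewrite /H_exp; lia.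
Qed.

Lemma H_sum0 j : H_sum j 0 = 0.
Proof.
apply: powserP => n; rewrite /= big1 // => t _.
by rewrite /H_term mul0n subrr mulr0.
Qed.

(** Regrouping the four powers of q in the difference of n-th terms leaves a factor 1 - q^(2n) on
    one half, [U], and 1 - q^(2(n+j+1)) on the other, [V]. The coefficient recurrences absorb both
    factors once [U] is shifted by one. *)
Lemma H_sum_diff j s : (s < k)%N ->
  H_sum j s.+1 - H_sum j s = q ^+ (2 * j.+1 * s) * J_sum j.+1 (k - s.+1).
Proof.
move=> sk.
pose U n := (-1) ^+ n * andrews_coef j n * q ^+ H_exp j s.+1 n * (1 - q ^+ (2 * n)).
pose V n := (-1) ^+ n * andrews_coef j n
  * q ^+ (H_exp j s n + 2 * s * (2 * n + j).+1) * (1 - q ^+ (2 * (n + j).+1)).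
have U_sum : ps_summable U.
  by move=> n; rewrite /U -mulrA mulrCA; apply: eqmodq_qX0; rewrite /H_exp; lia.
have -> : H_sum j s.+1 - H_sum j s = ps_sum (fun n => U n + V n).
  rewrite -ps_sumB; apply: eq_ps_sum => n; rewrite /H_term /U /V.
  have -> : H_exp j s n = (H_exp j s.+1 n + 2 * n)%N by rewrite /H_exp; nia.
  have -> : (2 * s.+1 * (2 * n + j).+1 =
             2 * s * (2 * n + j).+1 + 2 * (n + j).+1 + 2 * n)%N by nia.
  by rewrite !exprD; ring.
(* [U 0] vanishes, so the shift of [U] leaves no boundary term. *)
rewrite ps_sumD (ps_sum_recl U_sum) {1}/U muln0 subrr mulr0 add0r -ps_sumD.
rewrite /J_sum mulrDr mulrA -exprD -!ps_sumMl; try exact: H_term_summable.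
rewrite -ps_sumD; apply: eq_ps_sum => n.
have -> : U n.+1 = - ((-1) ^+ n * andrews_coef j.+1 n)
    * (q ^+ H_exp j s.+1 n.+1 + q ^+ (H_exp j s.+1 n.+1 + (2 * n + 1))).
  rewrite /U; move: (H_exp _ _ _) => e; rewrite exprD exprS.
  transitivity (- (-1) ^+ n * q ^+ e
    * (andrews_coef j n.+1 * (1 - q ^+ (2 * n.+1)))); first by ring.
  by rewrite andrews_coef_recr; ring.
set e := (H_exp j s n + 2 * s * (2 * n + j).+1)%N.
have -> : V n = (-1) ^+ n * andrews_coef j.+1 n
    * (q ^+ e + q ^+ (e + (2 * (n + j).+1 + 1))).
  rewrite /V -/e; move: e => e; rewrite exprD.
  transitivity ((-1) ^+ n * q ^+ e
    * (andrews_coef j n * (1 - q ^+ (2 * (n + j).+1)))); first by ring.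
  by rewrite andrews_coef_recl; ring.
(* Writing k as s + 1 + d removes the truncated subtractions. [E1] to [E4] then match the powers of
   q from [V] and the shifted [U] with those of the two H series in J. *)
have [d Ek] : exists d, k = (s.+1 + d)%N by exists (k - s.+1)%N; lia.
have E1 : (2 * j.+1 * s + H_exp j.+1 (k - s.+1).+1 n = e)%N.
  by rewrite /e /H_exp Ek; nia.
have E2 : (2 * j.+1 * s + H_exp j.+1 (k - s.+1).+1 n
   + 2 * (k - s.+1).+1 * (2 * n + j.+1).+1 = H_exp j s.+1 n.+1 + (2 * n + 1))%N.
  by rewrite /H_exp Ek; nia.
have E3 : (2 * j.+1 * s + (2 * j.+1 + 1) + H_exp j.+1 (k - s.+1) n
           = e + (2 * (n + j).+1 + 1))%N.
  by rewrite /e /H_exp Ek; nia.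
have E4 : (2 * j.+1 * s + (2 * j.+1 + 1) + H_exp j.+1 (k - s.+1) n
   + 2 * (k - s.+1) * (2 * n + j.+1).+1 = H_exp j s.+1 n.+1)%N.
  by rewrite /H_exp Ek; nia.
rewrite -E2 -E3 -{1}E4 -E1 /H_term; move: (H_exp _ _ _) (H_exp _ _ _) => e1 e2.
by rewrite !exprD; ring.
Qed.
End AndrewsFunctions.

(** * Gaussian binomial coefficients and the q-binomial theorem *)

Section QBinomial.
Variable R : comNzRingType.
Implicit Types Q X Y : R.

(** Defined by the q-Pascal rule rather than as a quotient, so that no factor 1 - Q^m has to be
    invertible. *)
Fixpoint qbin Q n r : R :=
  match n, r with
  | _, 0%N => 1
  | 0%N, _.+1 => 0
  | n'.+1, r'.+1 => qbin Q n' r' + Q ^+ r'.+1 * qbin Q n' r'.+1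
  end.

Arguments qbin : simpl never.

Definition qfact Q n : R := \prod_(m < n) (1 - Q ^+ m.+1).

Lemma qbinS Q n r : qbin Q n.+1 r.+1 = qbin Q n r + Q ^+ r.+1 * qbin Q n r.+1.
Proof. by []. Qed.

Lemma qbin0 Q n : qbin Q n 0 = 1.
Proof. by case: n. Qed.

Lemma qbin_small Q n r : (n < r)%N -> qbin Q n r = 0.
Proof.
elim: n r => [|n IHn] [|r] //; rewrite ltnS => nr.
by rewrite qbinS !IHn ?mulr0 ?addr0 // ltnW.
Qed.

Lemma qfactS Q n : qfact Q n.+1 = qfact Q n * (1 - Q ^+ n.+1).
Proof. exact: big_ord_recr. Qed.

(** The induction step rests on 1 - Q^(r+d+2) = (1 - Q^(r+1)) + Q^(r+1) (1 - Q^(d+1)). *)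
Lemma qbin_fact Q r d : qbin Q (r + d) r * (qfact Q r * qfact Q d) = qfact Q (r + d).
Proof.
have f0 : qfact Q 0 = 1 by rewrite /qfact big_ord0.
elim: r d => [|r IHr] d; first by rewrite qbin0 f0 !mul1r.
elim: d => [|d IHd].
  have := IHr 0%N; rewrite !addn0 qbinS (@qbin_small Q r r.+1) // mulr0 addr0.
  rewrite f0 !mulr1.
  by rewrite !qfactS mulrA => ->.
have E1 := IHr d.+1; have E2 := IHd; rewrite addSnnS in E2.
rewrite addSn qbinS [RHS]qfactS.
transitivity (qbin Q (r + d.+1) r * (qfact Q r * qfact Q d.+1) * (1 - Q ^+ r.+1)
  + Q ^+ r.+1 * (qbin Q (r + d.+1) r.+1 * (qfact Q r.+1 * qfact Q d))
    * (1 - Q ^+ d.+1)).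
  by rewrite !qfactS; ring.
by rewrite E1 E2 -[(r + d.+1).+1]addSn exprD; ring.
Qed.

(** Splitting off the factor m = 0 replaces X by XQ in the others. The homogeneous form in X and Y
    avoids negative powers of Q in the triple product. *)
Lemma qbinomial_theorem Q X Y n :
  \prod_(m < n) (Y + X * Q ^+ m) =
  \sum_(r < n.+1) qbin Q n r * Q ^+ 'C(r, 2) * X ^+ r * Y ^+ (n - r).
Proof.
elim: n X => [|n IHn] X; first by rewrite big_ord0 big_ord1 /= !mulr1.
rewrite big_ord_recl mulr1; under eq_bigr do rewrite lift0 exprS mulrA.
rewrite IHn mulrDl addrC.
rewrite [RHS]big_ord_recl qbin0.
under [X in _ = _ + X]eq_bigr => i _.
  rewrite lift0 subSS binS bin1 qbinS !mulrDl.
  over.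
rewrite big_split /= addrCA mulr_sumr; congr (_ + _).
  by apply: eq_bigr => r _; rewrite exprMn exprD exprS; ring.
transitivity (\sum_(r < n.+2)
    qbin Q n r * Q ^+ r * Q ^+ 'C(r, 2) * X ^+ r * Y ^+ (n.+1 - r)).
  rewrite [RHS]big_ord_recr /= (@qbin_small Q n n.+1) // !mul0r addr0 mulr_sumr.
  apply: eq_bigr => r _; rewrite exprMn subSn ?exprS; first by ring.
  by rewrite -ltnS.
rewrite [LHS]big_ord_recl qbin0 expr0 mulr1; congr (_ + _).
by apply: eq_bigr => r _; rewrite lift0 subSS binS bin1; ring.
Qed.

End QBinomial.

(** * A finite form of the Jacobi triple product *)

Lemma bin2D a b : ('C(a + b, 2) = 'C(a, 2) + 'C(b, 2) + a * b)%N.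
Proof.
elim: a => [|a IHa]; first by rewrite bin0n mul0n addn0.
by rewrite addSn !binS !bin1 IHa; lia.
Qed.

Lemma bin2_sqr n : ('C(n, 2) * 2 + n = n * n)%N.
Proof. by elim: n => // n IHn; rewrite binS bin1; lia. Qed.

Lemma jacobi_triple_product_fin (R : idomainType) (u v : R) N : u * v != 0 ->
  \prod_(r < N) ((1 - u * (u * v) ^+ r) * (1 - v * (u * v) ^+ r)) =
  \sum_(n < N.+1) qbin (u * v) (N + N) (N + n) *
    ((-1) ^+ n * ((u * v) ^+ 'C(n, 2) * v ^+ n)) +
  \sum_(n < N) qbin (u * v) (N + N) (N - n.+1) *
    ((-1) ^+ n.+1 * ((u * v) ^+ 'C(n.+1, 2) * u ^+ n.+1)).
Proof.
set Q := u * v => Q0.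
have v0 : v != 0 by apply: contraNneq Q0; rewrite /Q => ->; rewrite mulr0.
(* The q-binomial product with 2N factors, X = -v and Y = Q^N, is c times the left-hand side; c is
   cancelled in the integral domain. *)
pose c := (-1) ^+ N * v ^+ N * Q ^+ (N * N + 'C(N, 2)).
have c0 : c != 0 by rewrite !mulf_neq0 ?expf_neq0 // oppr_eq0 oner_neq0.
have prodC (x : R) : \prod_(i < N) x = x ^+ N by rewrite prodr_const card_ord.
apply: (mulfI c0); rewrite mulrDr !mulr_sumr.
transitivity (\prod_(m < N + N) (Q ^+ N + - v * Q ^+ m)).
  rewrite big_split_ord /= big_split /=.
  have -> : \prod_(i < N) (Q ^+ N + - v * Q ^+ (N + i)) =
      Q ^+ (N * N) * \prod_(i < N) (1 - v * Q ^+ i).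
    rewrite exprM -[(_ ^+ N) ^+ N]prodC -big_split /=.
    by apply: eq_bigr => i _; rewrite exprD; ring.
  have -> : \prod_(i < N) (Q ^+ N + - v * Q ^+ i) =
      (- v) ^+ N * Q ^+ 'C(N, 2) * \prod_(i < N) (1 - u * Q ^+ i).
    (* As Q = uv, the factor Q^N - v Q^i equals -v Q^i (1 - u Q^(N-1-i)), hence the reversal of the
       index. *)
    rewrite [X in _ * X](reindex_inj rev_ord_inj) /=.
    rewrite -triangular_sum big_mkord -prodrXr -[(- v) ^+ N]prodC -!big_split /=.
    apply: eq_bigr => i _.
    have {1}-> : N = ((N - i.+1) + i).+1 by have := ltn_ord i; lia.
    by rewrite exprS exprD /Q; ring.
  by rewrite /c exprD [(- v) ^+ N]exprNn; ring.
(* The sum is split at r = N: the indices N + n give the powers of v and the indices N - n - 1 those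
   of u. *)
rewrite qbinomial_theorem -addnS big_split_ord [LHS]addrC /=; congr (_ + _).
  apply: eq_bigr => n _; rewrite subnDl -exprM [(- v) ^+ _]exprNn.
  transitivity (qbin Q (N + N) (N + n) * ((-1) ^+ (N + n) * v ^+ (N + n)) *
    Q ^+ ('C(N + n, 2) + N * (N - n))); first by rewrite [Q ^+ (_ + _)]exprD; ring.
  have -> : ('C(N + n, 2) + N * (N - n) = N * N + 'C(N, 2) + 'C(n, 2))%N.
    by rewrite bin2D; have := ltn_ord n; nia.
  by rewrite /c !exprD; ring.
rewrite (reindex_inj rev_ord_inj) /=; apply: eq_bigr => n _.
have nN := ltn_ord n; rewrite -exprM [(- v) ^+ _]exprNn.
have [m Em] : exists m, N = (m + n.+1)%N by exists (N - n.+1)%N; lia.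
have -> : (N - n.+1)%N = m by lia.
transitivity (qbin Q (N + N) m * ((-1) ^+ m * v ^+ m) *
  Q ^+ ('C(m, 2) + N * (N + N - m))); first by rewrite [Q ^+ (_ + _)]exprD; ring.
have -> : ('C(m, 2) + N * (N + N - m) =
           N * N + 'C(N, 2) + 'C(n.+1, 2) + n.+1)%N.
  have := bin2D m n.+1; rewrite -Em => ->.
  have -> : (N + N - m = N + n.+1)%N by lia.
  have := bin2_sqr n.+1; have : (N * n.+1 = m * n.+1 + n.+1 * n + n.+1)%N by nia.
  by rewrite mulnDr; lia.
have sg : (-1) ^+ n.+1 * (-1) ^+ n.+1 = 1 :> R.
  by rewrite -exprMn mulrNN mulr1 expr1n.
rewrite /c; set w := (-1) ^+ n.+1 in sg *; move: (qbin _ _ _) ('C(n.+1, 2)) => b e.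
transitivity (b * ((-1) ^+ m * (w * w) * v ^+ (m + n.+1))
  * Q ^+ (N * N + 'C(N, 2)) * Q ^+ e * u ^+ n.+1).
  by rewrite sg !exprD [Q ^+ n.+1]exprMn; ring.
have EN : (-1) ^+ N = (-1) ^+ m * w by rewrite /w -exprD -Em.
by rewrite -Em EN; ring.
Qed.

(** The representative c lies in 1..M rather than 0..M-1, so that the class of 0 is covered by c = M
    while all exponents stay positive. *)
Lemma prod_residue_class (R : comNzRingType) (M c N : nat) (F : nat -> R) :
  (0 < c <= M)%N ->
  \prod_(1 <= m < (M * N).+1 | m == c %[mod M]) F m =
  \prod_(r < N) F (M * r + c)%N.
Proof.
move=> /andP[c0 cM]; elim: N => [|N IHN].
  by rewrite muln0 big_geq // big_ord0.
rewrite (@big_cat_nat _ _ _ (M * N).+1) //=; last by rewrite ltnS leq_mul2l leqnSn orbT.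
rewrite IHN big_ord_recr /=; congr (_ * _).
(* The last block, from MN + 1 to MN + M, meets the class exactly once. *)
rewrite big_nat_cond (eq_bigl (pred1 (M * N + c)%N)) => [|m]; last first.
  rewrite /= mulnS; apply/andP/eqP => [[/andP[lo hi] /eqP Em]|->].
    have : (m - M * N == c %[mod M])%N.
      rewrite -(eqn_modDl (M * N)) subnKC; last by lia.
      by rewrite Em mulnC modnMDl.
    case: (eqVneq c M) => [->|cM'].
      rewrite modnn => /eqP E; have : (M %| m - M * N)%N by apply/eqP.
      by move=> /dvdn_leq -/(_ _)%N H; have := H ltac:(lia); lia.
    rewrite (modn_small (_ : c < M)%N); last by lia.
    case: (ltnP (m - M * N) M) => H; first by rewrite modn_small // => /eqP; lia.
    have -> : (m - M * N = M)%N by lia.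
    by rewrite modnn => /eqP; lia.
  by split; [lia | rewrite mulnC modnMDl].
by rewrite -big_filter filter_pred1_uniq ?iota_uniq ?mem_index_iota ?big_seq1 //; lia.
Qed.

(** * The product P and the congruence for P times J *)

Section Products.
Variable K : fieldType.
Local Notation q := (ps_q K).
Local Notation geom m := (1 - q ^+ m)^-1.

Lemma eqmodq_iprod (P : pred nat) (F : nat -> powser K) n N :
  (forall m, P m -> eqmodq m (F m) 1) -> (n <= N.+1)%N ->
  eqmodq n (ps_iprod P F) (\prod_(1 <= m < N.+1 | P m) F m).
Proof.
move=> HF nN t tn; apply: ps_iprodE => //; lia.
Qed.

Lemma eqmodq_geom m : (0 < m)%N -> eqmodq m (geom m) 1.
Proof.
move=> m0; apply: (@eqmodqMI _ _ (1 - q ^+ m)); first exact: unit_1BqX.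
rewrite divrr ?unit_1BqX // mulr1.
exact/eqmodq_sym/eqmodq_1BqX.
Qed.

(** This is (-q; q^2)_oo / (q^2; q^2)_oo, the factor divided out of the H series. *)
Definition P_prod := ps_iprod (fun m => m != 2 %[mod 4])%N (fun m => geom m).

Lemma eqmodq_P_prod n N : (n <= N.+1)%N ->
  eqmodq n P_prod (\prod_(1 <= m < N.+1 | m != 2 %[mod 4]) geom m).
Proof.
move=> nN; apply: eqmodq_iprod => // -[|m] _ //; exact: eqmodq_geom.
Qed.

(** For odd m, (1 + q^m)(1 - q^m) = 1 - q^(2m) with 2m = 2 mod 4, which supplies the even factors
    missing on the left. The truncated products do not match exactly, so the factors 1 - q^(4r+2)
    remain on both sides with different ranges. *)
Lemma P_prod_partial N :
  odd_poch K (2 * N) * (\prod_(1 <= m < (4 * N).+1 | m != 2 %[mod 4]) (1 - q ^+ m))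
    * \prod_(r < N) (1 - q ^+ (4 * r + 2)) =
  even_poch K (2 * N) * \prod_(r < 2 * N) (1 - q ^+ (4 * r + 2)).
Proof.
rewrite big_mkcond; elim: N => [|N IHN].
  by rewrite muln0 /odd_poch /even_poch !big_ord0 big_geq // !mulr1.
rewrite !mulnS !addSn !add0n 4?big_nat_recr //.
rewrite !big_ord_recr !even_pochS !odd_pochS.
have -> : ((4 * N).+1 == 2 %[mod 4])%N = false by lia.
have -> : ((4 * N).+2 == 2 %[mod 4])%N = true by lia.
have -> : ((4 * N).+3 == 2 %[mod 4])%N = false by lia.
have -> : ((4 * N).+4 == 2 %[mod 4])%N = false by lia.
rewrite /= mulr1.
have -> : (2 * (2 * N) + 1 = (4 * N).+1)%N by lia.
have -> : (2 * (2 * N).+1 + 1 = (4 * N).+3)%N by lia.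
have -> : (2 * (2 * N) + 2 = (4 * N).+2)%N by lia.
have -> : (2 * (2 * N).+1 + 2 = (4 * N).+4)%N by lia.
have -> : (4 * (2 * N) + 2 = (4 * N).+1 + (4 * N).+1)%N by lia.
have -> : (4 * (2 * N).+1 + 2 = (4 * N).+3 + (4 * N).+3)%N by lia.
have -> : (4 * N + 2 = (4 * N).+2)%N by lia.
rewrite !(exprD q (4 * N).+1 (4 * N).+1) !(exprD q (4 * N).+3 (4 * N).+3).
move: IHN; set c := \prod_(1 <= i < _) _; set d := \prod_(i < N) _.
set d' := \prod_(i < 2 * N) _; move: c d d' => c d d' IHN.
move: (q ^+ (4 * N).+1) (q ^+ (4 * N).+2) (q ^+ (4 * N).+3) (q ^+ (4 * N).+4).
move=> x1 x2 x3 x4.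
transitivity (odd_poch K (2 * N) * c * d * ((1 + x1) * (1 + x3) * (1 - x1)
  * (1 - x3) * (1 - x4) * (1 - x2))); first by ring.
by rewrite IHN; ring.
Qed.

Lemma eqmodq_odd_poch m n : (m <= n)%N ->
  eqmodq (2 * m + 1) (odd_poch K m) (odd_poch K n).
Proof.
elim: n => [|n IHn]; first by rewrite leqn0 => /eqP ->.
rewrite leq_eqVlt => /orP[/eqP -> //|]; rewrite ltnS => mn.
rewrite odd_pochS -[odd_poch K m]mulr1; apply: eqmodqM; first exact: IHn.
apply: eqmodq_sym => t tm; rewrite coefsD -[q ^+ _]mulr1.
by rewrite (@eqmodq_qX0 _ (2 * m + 1)) ?addr0 //; lia.
Qed.

Lemma eqmodq_even_poch m n : (m <= n)%N ->
  eqmodq (2 * m + 2) (even_poch K m) (even_poch K n).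
Proof.
elim: n => [|n IHn]; first by rewrite leqn0 => /eqP ->.
rewrite leq_eqVlt => /orP[/eqP -> //|]; rewrite ltnS => mn.
rewrite even_pochS -[even_poch K m]mulr1; apply: eqmodqM; first exact: IHn.
by apply/eqmodq_sym/eqmodq_1BqX; lia.
Qed.

Lemma eqmodq_P_prod_poch N :
  eqmodq (4 * N + 1) (P_prod * even_poch K (2 * N)) (odd_poch K (2 * N)).
Proof.
pose D := \prod_(1 <= m < (4 * N).+1 | m != 2 %[mod 4]) (1 - q ^+ m).
pose V := \prod_(1 <= m < (4 * N).+1 | m != 2 %[mod 4]) geom m.
have VD : V * D = 1.
  rewrite /V /D -big_split /= big_nat_cond big1 // => m /andP[/andP[m0 _] _].
  by rewrite mulVr // unit_1BqX.
have E : eqmodq (4 * N + 1) (odd_poch K (2 * N) * D) (even_poch K (2 * N)).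
  pose W n := \prod_(r < n) (1 - q ^+ (4 * r + 2)).
  have WU n : W n \is a GRing.unit.
    by apply: rpred_prod => r _; apply: unit_1BqX; rewrite addn2.
  (* The extra factors have exponents at least 4N + 2. *)
  have WW : eqmodq (4 * N + 1) (W N) (W (2 * N)%N).
    rewrite mul2n -addnn /W big_split_ord /= -[X in eqmodq _ X]mulr1.
    apply: eqmodqM => //; apply: eqmodq_sym.
    by apply: eqmodq_prod1 => i _; apply: eqmodq_1BqX; lia.
  apply: (eqmodqMI (WU N)); rewrite mulrC P_prod_partial mulrC.
  by apply: eqmodqM => //; apply: eqmodq_sym.
have := eqmodqM (@eqmodq_P_prod (4 * N + 1) (4 * N) _) (eqmodq_sym E).
rewrite addn1 -/V => /(_ (ltnSn _)) /eqmodq_trans; apply.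
by rewrite mulrCA VD mulr1.
Qed.

(** The coefficient is (q^2; q^2)_j / (-q; q^2)_(j+1), a truncation of the infinite product 1 /
    P. *)
Lemma eqmodq_P_andrews_coef j : eqmodq (2 * j + 1) (P_prod * andrews_coef K j 0) 1.
Proof.
have U : even_poch K 0 * odd_poch K j.+1 \is a GRing.unit.
  by rewrite unitrM unit_even_poch unit_odd_poch.
apply: (eqmodqMI U); rewrite mulrCA -{1}(add0n j) andrews_coefP add0n mulr1.
have -> : odd_poch K 0 = 1 by rewrite /odd_poch big_ord0.
have -> : even_poch K 0 = 1 by rewrite /even_poch big_ord0.
rewrite !mul1r.
apply: (@eqmodq_trans _ _ _ (P_prod * even_poch K (2 * j))).
  apply: eqmodqM => //; apply: (eqmodq_leq _ (eqmodq_even_poch _)); lia.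
apply: (eqmodq_trans (eqmodq_leq _ (@eqmodq_P_prod_poch j))); first by lia.
(* For j = 0 the length j + 1 exceeds 2j, so both symbols are compared with the one of length j. *)
apply: (@eqmodq_trans _ _ _ (odd_poch K j)).
  by apply/eqmodq_sym/eqmodq_odd_poch; lia.
exact: eqmodq_odd_poch.
Qed.

Variable k : nat.

Lemma eqmodq_J_sum j s : (s < k)%N ->
  eqmodq (2 * j + 1) (P_prod * J_sum K k j s) 1.
Proof.
move=> sk.
have HA : eqmodq (2 * j + 1) (J_sum K k j s) (andrews_coef K j 0).
  rewrite -[andrews_coef K j 0]addr0 /J_sum addn1.
  apply: eqmodqD; last exact: eqmodq_qX0.
  apply: (eqmodq_trans (eqmodq_ps_sum (@H_term_summable K k j s.+1))).
  rewrite big_ord_recl -[andrews_coef K j 0]addr0; apply: eqmodqD.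
    rewrite /H_term /H_exp muln0 mul0n /= !mulr1 mul1r -[X in eqmodq _ _ X]mulr1.
    by apply: eqmodqM => //; apply: eqmodq_1BqX; nia.
  apply: eqmodq_sum0 => i _; rewrite lift0 /H_term -mulrA mulrCA.
  by apply: eqmodq_qX0; rewrite /H_exp; nia.
apply: (@eqmodq_trans _ _ _ (P_prod * andrews_coef K j 0)).
  exact: eqmodqM.
exact: eqmodq_P_andrews_coef.
Qed.

End Products.

(** * The case j = 0: theta products and theta series *)

Section Theta.
Variables (K : fieldType) (k i : nat).
Hypotheses (i_gt0 : (0 < i)%N) (i_le_k : (i <= k)%N).
Local Notation q := (ps_q K).
Local Notation M := (4 * k)%N.
Local Notation a := (2 * k - (2 * i - 1))%N.
Local Notation b := (2 * k + (2 * i - 1))%N.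

Let k_gt0 : (0 < k)%N. Proof. exact: leq_trans i_le_k. Qed.

(** The residues excluded from G_i; the class of 0 is written as that of 4k to fit
    [prod_residue_class]. *)
Definition theta_index : pred nat := fun m =>
  [|| m == M %[mod M], m == a %[mod M] | m == b %[mod M]].

Definition theta_prod := ps_iprod theta_index (fun m => 1 - q ^+ m).

Lemma eqmodq_theta_prod n N : (n <= N.+1)%N ->
  eqmodq n theta_prod (\prod_(1 <= m < N.+1 | theta_index m) (1 - q ^+ m)).
Proof. by move=> nN; apply: eqmodq_iprod => // m _; apply: eqmodq_1BqX. Qed.

Lemma modn4_mod m c : m = c %[mod M] -> m = c %[mod 4].
Proof.
move=> E; rewrite -(modn_dvdm m (dvdn_mulr k (dvdnn 4))) E.
by rewrite modn_dvdm ?dvdn_mulr.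
Qed.

Lemma G_index_theta m :
  G_index k i m = (m != 2 %[mod 4])%N && ~~ theta_index m.
Proof.
rewrite /G_index /theta_index modnn mod0n !negb_or.
by congr [&& _, _ & _]; rewrite andbC.
Qed.

Lemma theta_index_mod4 m : theta_index m -> (m != 2 %[mod 4])%N.
Proof. by case/or3P=> /eqP /modn4_mod; lia. Qed.

(** The excluded residues are multiples of 4 or odd, so each factor of the theta product cancels a
    factor actually present in P. *)
Lemma G_prod_theta : G_prod K k i = P_prod K * theta_prod.
Proof.
apply: eqmodq_eq => n; apply: eqmodq_sym.
have := eqmodqM (@eqmodq_P_prod K n n (leqnSn n)) (eqmodq_theta_prod (leqnSn n)).
move=> /eqmodq_trans; apply.
move=> t tn; rewrite (@G_prodE _ _ _ n) 1?ltnW //; congr (coefs _ t).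
rewrite !(big_mkcond (fun m => m != _ %[mod _])%N) (big_mkcond theta_index).
rewrite (big_mkcond (G_index _ _)) -big_split /=.
rewrite big_nat_cond [RHS]big_nat_cond; apply: eq_bigr => m /andP[/andP[m0 _] _].
rewrite G_index_theta; have := @theta_index_mod4 m.
case: (theta_index m) => [->//|_]; rewrite ?andbT ?mulr1 //.
by rewrite mulVr // unit_1BqX.
Qed.

Lemma theta_prod_partial N :
  \prod_(1 <= m < (M * N).+1 | theta_index m) (1 - q ^+ m) =
  qfact (q ^+ M) N * \prod_(r < N)
    ((1 - q ^+ a * (q ^+ a * q ^+ b) ^+ r) * (1 - q ^+ b * (q ^+ a * q ^+ b) ^+ r)).
Proof.
have ->: \prod_(1 <= m < (M * N).+1 | theta_index m) (1 - q ^+ m) =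
  \prod_(1 <= m < (M * N).+1 | m == M %[mod M]) (1 - q ^+ m) *
  (\prod_(1 <= m < (M * N).+1 | m == a %[mod M]) (1 - q ^+ m) *
  \prod_(1 <= m < (M * N).+1 | m == b %[mod M]) (1 - q ^+ m)).
  rewrite big_mkcond [X in _ = X * _]big_mkcond [X in _ = _ * (X * _)]big_mkcond.
  rewrite [X in _ = _ * (_ * X)]big_mkcond -!big_split; apply: eq_bigr => m _ /=.
  rewrite /theta_index modnn (@modn_small a); last by lia.
  rewrite (@modn_small b); last by lia.
  case: eqP => [->|_]; first by rewrite !ifF ?mulr1 //; apply/eqP; lia.
  case: eqP => [->|_]; first by rewrite !ifF ?mulr1 ?mul1r //; apply/eqP; lia.
  by case: eqP; rewrite !mul1r.
rewrite !prod_residue_class; try lia.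
rewrite big_split; congr (_ * (_ * _)); apply: eq_bigr => r _ /=.
- by rewrite -exprM; congr (1 - q ^+ _); lia.
- by rewrite -exprD -exprM -exprD; congr (1 - q ^+ _); nia.
- by rewrite -exprD -exprM -exprD; congr (1 - q ^+ _); nia.
Qed.

Lemma unit_qfact n : qfact (q ^+ M) n \is a GRing.unit.
Proof.
by apply: rpred_prod => r _; rewrite -exprM unit_1BqX // !muln_gt0 k_gt0.
Qed.

Lemma eqmodq_qfact m n : (m <= n)%N ->
  eqmodq (M * m.+1) (qfact (q ^+ M) m) (qfact (q ^+ M) n).
Proof.
elim: n => [|n IHn]; first by rewrite leqn0 => /eqP ->.
rewrite leq_eqVlt => /orP[/eqP -> //|]; rewrite ltnS => mn.
rewrite qfactS -[qfact _ m]mulr1; apply: eqmodqM; first exact: IHn.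
by rewrite -exprM; apply/eqmodq_sym/eqmodq_1BqX; rewrite leq_mul2l ltnS mn orbT.
Qed.

(** The limit of Gaussian binomials: all the q-factorials involved agree with [qfact Q m] modulo
    Q^(m+1), so the quotient formula reduces to 1. *)
Lemma eqmodq_qfact_qbin m e r d : (m <= e)%N -> (m <= r)%N -> (m <= d)%N ->
  eqmodq (M * m.+1) (qfact (q ^+ M) e * qbin (q ^+ M) (r + d) r) 1.
Proof.
move=> me mr md; set Q := q ^+ M; set B := qbin _ _ _.
have E n : (m <= n)%N -> eqmodq (M * m.+1) (qfact Q n) (qfact Q m).
  by move=> mn; apply/eqmodq_sym/eqmodq_qfact.
apply: (@eqmodq_trans _ _ _ (qfact Q m * B)); first by apply: eqmodqM => //; apply: E.
apply: (eqmodqMI (unit_qfact m)); rewrite mulr1 -/Q.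
apply: (@eqmodq_trans _ _ _ (qfact Q (r + d))); last by apply: E; lia.
rewrite -qbin_fact -/B [qfact Q m * B]mulrC mulrCA.
by apply: eqmodqM => //; apply: eqmodqM; apply: eqmodq_sym; apply: E.
Qed.

(** The terms of indices n and -n-1 of the bilateral theta series, paired. *)
Definition theta_term n : powser K :=
  (-1) ^+ n * q ^+ (M * 'C(n, 2) + b * n)
  - (-1) ^+ n * q ^+ (M * 'C(n.+1, 2) + a * n.+1).

Lemma theta_term_summable : ps_summable theta_term.
Proof.
move=> n; rewrite -(subrr 0); apply: eqmodqD; last apply: eqmodqN.
  by rewrite mulrC; apply: eqmodq_qX0; nia.
rewrite mulrC; apply: eqmodq_qX0.
have := bin2_sqr n.+1; nia.
Qed.

Lemma theta_prod_sum : theta_prod = ps_sum theta_term.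
Proof.
apply: eqmodq_eq => N; apply: eqmodq_sym.
apply: (eqmodq_trans (eqmodq_ps_sum theta_term_summable)).
apply: eqmodq_sym.
(* Truncating at 4kN gives N full periods, hence the finite triple product. *)
apply: (eqmodq_trans (@eqmodq_theta_prod N (M * N) _)); first by nia.
have Euv : q ^+ a * q ^+ b = q ^+ M by rewrite -exprD; congr (q ^+ _); lia.
have Q0 : q ^+ a * q ^+ b != 0 by rewrite -exprD expf_neq0 // ps_q_neq0.
rewrite theta_prod_partial jacobi_triple_product_fin // Euv mulrDr !mulr_sumr.
rewrite sumrB; apply: eqmodqD; last first.
  rewrite -sumrN; apply: eqmodq_sum => n _.
  have nN := ltn_ord n.
  rewrite exprS mulN1r mulNr !mulrN -!exprM -exprD; apply: eqmodqN.
  set e := (M * _ + _)%N; rewrite mulrA [X in eqmodq _ X]mulrC.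
  rewrite -mulrA; apply: eqmodqM => //.
  rewrite -[X in eqmodq _ _ X]mulr1.
  (* The Gaussian binomial is less accurate for large n, but the exponent e of the term makes up for
     the loss. *)
  apply: (@eqmodq_qXM _ (M * (N - n.+1).+1)).
    have := bin2_sqr n.+1; rewrite /e; nia.
  have -> : (N + N = (N - n.+1) + (N + n.+1))%N by lia.
  by apply: eqmodq_qfact_qbin; lia.
(* The extra term n = N of this sum vanishes modulo q^N. *)
rewrite big_ord_recr /= -[X in eqmodq _ _ X]addr0.
have T n : (n <= N)%N -> eqmodq N
    (qfact (q ^+ M) N * (qbin (q ^+ M) (N + N) (N + n) *
      ((-1) ^+ n * ((q ^+ M) ^+ 'C(n, 2) * (q ^+ b) ^+ n))))
    ((-1) ^+ n * q ^+ (M * 'C(n, 2) + b * n)).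
  move=> nN; rewrite -!exprM -exprD.
  set e := (M * _ + _)%N; rewrite mulrA [X in eqmodq _ X]mulrC.
  rewrite -mulrA; apply: eqmodqM => //.
  rewrite -[X in eqmodq _ _ X]mulr1.
  apply: (@eqmodq_qXM _ (M * (N - n).+1)).
    have := bin2_sqr n; rewrite /e; nia.
  have -> : (N + N = (N + n) + (N - n))%N by lia.
  by apply: eqmodq_qfact_qbin; lia.
apply: eqmodqD; first by apply: eqmodq_sum => n _; apply: T; apply: ltnW.
apply: (eqmodq_trans (T N (leqnn N))); rewrite mulrC.
by apply: eqmodq_qX0; nia.
Qed.

(** At j = 0 the four powers of q in the n-th term of J factor as (1 + q^(2n+1)) times a difference
    of two, and [andrews_coef0] cancels the first factor. *)
Lemma theta_sum_J : ps_sum theta_term = J_sum K k 0 (k - i).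
Proof.
rewrite /J_sum -ps_sumMl; last exact: H_term_summable.
rewrite -ps_sumD; apply: eq_ps_sum => n.
set s := (k - i)%N.
have E2 : (M * 'C(n.+1, 2) + a * n.+1 =
   2 * 0 + 1 + H_exp k 0 s n + 2 * s * (2 * n + 0).+1)%N.
  by have := bin2_sqr n.+1; rewrite /H_exp /s; nia.
have E1 : (M * 'C(n, 2) + b * n = H_exp k 0 s.+1 n)%N.
  by have := bin2_sqr n; rewrite /H_exp /s; nia.
have E3 : (H_exp k 0 s.+1 n + 2 * s.+1 * (2 * n + 0).+1 =
   (2 * 0 + 1 + H_exp k 0 s n + 2 * s * (2 * n + 0).+1) + (2 * n + 1))%N.
  by rewrite /H_exp /s; nia.
have E4 : (2 * 0 + 1 + H_exp k 0 s n = H_exp k 0 s.+1 n + (2 * n + 1))%N.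
  rewrite /H_exp; have -> : (k - s = (k - s.+1).+1)%N by lia.
  by move: (k - s.+1)%N (k * (n + 0))%N => d c; lia.
rewrite /theta_term E1 E2.
transitivity ((-1) ^+ n * andrews_coef K 0 n
  * (q ^+ H_exp k 0 s.+1 n - q ^+ (H_exp k 0 s.+1 n + 2 * s.+1 * (2 * n + 0).+1)
     + q ^+ (2 * 0 + 1 + H_exp k 0 s n)
     - q ^+ (2 * 0 + 1 + H_exp k 0 s n + 2 * s * (2 * n + 0).+1))); last first.
  rewrite /H_term; move: (H_exp _ _ _ _) (H_exp _ _ _ _) => e1 e2.
  by rewrite !exprD; ring.
rewrite E3; set e2 := (_ + 2 * s * _)%N; rewrite E4; have := andrews_coef0 K n.
move: (H_exp _ _ _ _) e2 (2 * n + 1)%N => e1 e2 m EA.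
transitivity ((-1) ^+ n * ((1 + q ^+ m) * andrews_coef K 0 n) * (q ^+ e1 - q ^+ e2)).
  by rewrite EA; ring.
by rewrite !exprD; ring.
Qed.

End Theta.

(** Passes from an identity with denominators cleared, provable in K[[q]], to the form of the
    recursion in K((q)). *)
Lemma eq_divB_solve (F : fieldType) (x y p f f' g g' : F) : x != 0 -> y != 0 ->
  p * (x * (f - f')) = p * (y * (x * g + g')) ->
  (p * f - p * f') / y - x^-1 * (p * g') = p * g.
Proof.
move=> x0 y0 E; apply: (mulfI (mulf_neq0 x0 y0)).
transitivity (p * (x * (f - f')) - y * (p * g')); first by field; rewrite x0 y0.
by rewrite E; ring.
Qed.

(** * The closed form of G_l *)

Section ClosedForm.
Variables (K : fieldType) (k : nat).
Local Notation q := (ps_q K).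
Local Notation J := (J_sum K k).

Lemma G_prod_J i : (1 <= i <= k)%N -> G_prod K k i = P_prod K * J 0 (k - i).
Proof.
by move=> /andP[i0 ik]; rewrite G_prod_theta // theta_prod_sum // theta_sum_J.
Qed.

(** Since (k-1)(j+1) + 1 = (k-1)j + k, this index has two closed forms, which must agree. *)
Lemma J_sum_last j : (0 < k)%N -> J j 0 = J j.+1 (k - 1).
Proof.
move=> k0; rewrite {1}/J_sum H_sum0 mulr0 addr0 -[LHS]subr0 -(H_sum0 K k j).
by rewrite H_sum_diff // muln0 mul1r.
Qed.

(** Two uses of [H_sum_diff], for s + 1 and s; the extra factor q turns the weight q^(2j+1) in J
    into q^(2j+2), which merges with q^(2(j+1)s). *)
Lemma J_sum_diff j s : (s.+1 < k)%N ->
  q * (J j s.+1 - J j s) =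
  q ^+ (2 * j.+1 * s.+1) * (q * J j.+1 (k - s.+2) + J j.+1 (k - s.+1)).
Proof.
move=> sk; transitivity (q * (H_sum K k j s.+2 - H_sum K k j s.+1)
    + q ^+ (2 * j + 1).+1 * (H_sum K k j s.+1 - H_sum K k j s)).
  rewrite /J_sum exprS; move: (H_sum _ _ _ _) (H_sum _ _ _ _) (H_sum _ _ _ _).
  by move: (q ^+ (2 * j + 1)) => x h h' h''; ring.
move: (H_sum_diff K j sk) (H_sum_diff K j (ltnW sk)).
move: (H_sum K k j s.+2) (H_sum K k j s.+1) (H_sum K k j s) => h h' h'' -> ->.
have -> : (2 * j.+1 * s.+1 = (2 * j + 1).+1 + 2 * j.+1 * s)%N by lia.
by rewrite exprD; move: (J _ _) (J _ _) => f g; ring.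
Qed.

Lemma G_sequence_closed_form (G : nat -> laurent K) : (2 <= k)%N ->
  is_G_sequence k G -> forall j i, (1 <= i <= k)%N ->
  G ((k - 1) * j + i)%N = (P_prod K * J j (k - i))%:F.
Proof.
move=> k2 [G0 GS]; elim=> [|j IHj] i ik.
  by rewrite muln0 add0n G0 // G_prod_J.
have Ej : ((k - 1) * j.+1 = (k - 1) * j + (k - 1))%N by rewrite mulnS addnC.
elim: i ik => // -[|i] IHi ik.
  (* The index i = 1 at level j + 1 is i = k at level j. *)
  rewrite Ej -addnA subnK; last by lia.
  by rewrite IHj ?leqnn ?subnn ?J_sum_last //; lia.
have lq0 : lq K != 0 by rewrite tofrac_eq0 ps_q_neq0.
rewrite GS //= !subSS !subn0.
have -> : ((k - 1) * j + k - i.+2 + 1 = (k - 1) * j + (k - i.+1))%N.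
  by move: ((k - 1) * j)%N => c; lia.
have -> : ((k - 1) * j + k - i.+2 + 2 = (k - 1) * j + (k - i))%N.
  by move: ((k - 1) * j)%N => c; lia.
have -> : ((k - 1) * j.+1 + i.+2 - 1 = (k - 1) * j.+1 + i.+1)%N.
  by rewrite addnS subn1.
rewrite IHi; last by lia.
rewrite !IHj; try lia.
have -> : (k - (k - i.+1) = i.+1)%N by lia.
have -> : (k - (k - i) = i)%N by lia.
(* Divided by q times q^(2(j+1)(i+1)), this identity is the recursion for the index i + 2 at level j
   + 1. *)
have /(_ ltac:(lia)) := @J_sum_diff j i _.
move: (J j i.+1) (J j i) (J j.+1 (k - i.+2)) (J j.+1 (k - i.+1)) => f f' g g'.
move=> /(congr1 (fun h => (P_prod K * h)%:F)).
rewrite !(tofracM, tofracB, tofracD, tofracXn) -/(lq K).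
exact: eq_divB_solve lq0 (expf_neq0 _ lq0).
Qed.

End ClosedForm.

Theorem theorem4p1 (R : realType) (k : nat) (G : nat -> laurent R[i]) :
  (2 <= k)%N -> is_G_sequence k G ->
  forall j i : nat, (1 <= i <= k)%N ->
  exists gamma : powser R[i],
    G ((k - 1) * j + i)%N = 1 + lq R[i] ^+ (2 * j + 1) * gamma%:F.
Proof.
move=> k2 GS j i ik; have ki : (k - i < k)%N by lia.
have [gamma E] := eqmodqP (@eqmodq_J_sum R[i] k j _ ki).
exists gamma; rewrite (G_sequence_closed_form k2 GS) // E.
by rewrite tofracD tofrac1 tofracM tofracXn.
Qed.
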